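(* Let $I\subset[0,\infty)$ be an interval with interior $I^{\circ}$, let $f:I\to\mathbb{R}$ be three times differentiable on $I^{\circ}$, and let $a,b\in I^{\circ}$ with $a<b$ be such that $f'''\in L[a,b]$. Let $q>1$ and let $p$ satisfy $\frac1p+\frac1q=1$. Suppose that, for some fixed $s\in(0,1]$, the function $|f'''|^q$ is $s$-convex in the second sense on $[a,b]$. Then $$\left|\int_a^b f(x)\,dx-\frac{b-a}{6}\left[f(a)+4f\left(\frac{a+b}{2}\right)+f(b)\right]\right|\le \frac{(b-a)^4}{48}\left(\frac12\right)^{\frac1p}\left(\frac{\Gamma(2p+1)\Gamma(p+1)}{\Gamma(3p+2)}\right)^{\frac1p}$$ $$\times\left\{\left[\frac{1}{2^{s+1}(s+1)}|f'''(a)|^q+\frac{2^{s+1}-1}{2^{s+1}(s+1)}|f'''(b)|^q\right]^{\frac1q}+\left[\frac{2^{s+1}-1}{2^{s+1}(s+1)}|f'''(a)|^q+\frac{1}{2^{s+1}(s+1)}|f'''(b)|^q\right]^{\frac1q}\right\}.$$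
   Context: $\Gamma$ is the Gamma function and $L[a,b]$ denotes the Lebesgue integrable functions on $[a,b]$. For fixed $s\in(0,1]$, a real-valued function $g$ is $s$-convex in the second sense on $[a,b]\subset[0,\infty)$ if $g(\alpha x+\beta y)\le \alpha^s g(x)+\beta^s g(y)$ for all $x,y\in[a,b]$ and all $\alpha,\beta\ge 0$ with $\alpha+\beta=1$. *)

(* Defs.v *)
From HB Require Import structures.
From mathcomp Require Import all_boot all_order all_algebra.
From mathcomp Require Import all_classical all_reals all_analysis.

Set Implicit Arguments.
Unset Strict Implicit.
Unset Printing Implicit Defensive.

Import Order.TTheory GRing.Theory Num.Theory.
Import numFieldNormedType.Exports.

Local Open Scope classical_set_scope.
Local Open Scope ring_scope.

(* Euler's integral of the second kind; [Rintegral] is total, so this is the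
   Gamma function for 0 < x only (the integral diverges for x <= 0). *)
Definition Gamma (R : realType) (x : R) : R :=
  \int[@lebesgue_measure R]_(t in `]0, +oo[) (t `^ (x - 1) * expR (- t)).

(* s-convexity in the second sense; meant for 0 < s <= 1 and D a convex subset
   of the nonnegative reals. For s > 0 one has 0 `^ s = 0, as usual. *)
Definition s_convex2 (R : realType) (s : R) (D : set R) (g : R -> R) : Prop :=
  forall x y alpha beta : R, D x -> D y ->
    0 <= alpha -> 0 <= beta -> alpha + beta = 1 ->
    g (alpha * x + beta * y) <= alpha `^ s * g x + beta `^ s * g y.

(* Main.v *)
Require Import Defs.
From HB Require Import structures.
From mathcomp Require Import all_boot all_order all_algebra.
From mathcomp Require Import all_classical all_reals all_analysis.
From mathcomp Require Import measurable_realfun ring lra.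

Set Implicit Arguments.
Unset Strict Implicit.
Unset Printing Implicit Defensive.

Import Order.TTheory GRing.Theory Num.Theory.
Import numFieldNormedType.Exports.

Local Open Scope ring_scope.
Local Open Scope classical_set_scope.

(** The error of Simpson's rule is an integral of f''' against a cubic kernel.
Here that identity is used in differential form. Put l = b - a and
k(t) = t^2 (1/2 - t) / 6 on [0, 1/2]. Let x(t) = c + d t run from an endpoint c
of [a, b] to the midpoint, so that d = l for c = a and d = - l for c = b. Three
integrations by parts provide an explicit function V of t, built from f, f',
f'' and a primitive F of f, such that
  V'(t) = d^4 k(t) f'''(x(t))   ([half_simpson_is_derive]),
and the Simpson error is the difference of the two increments of V over
[0, 1/2], one for each endpoint. The boundary terms at the midpoint are even in
d, so they cancel in this difference.

Each increment is bounded by Hoelder's inequality. Convexity gives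
  |f'''(x(t))|^q <= t^s |f'''(c + d)|^q + (1 - t)^s |f'''(c)|^q,
whose right-hand side has an elementary primitive. The integral of k^p over
[0, 1/2] is a rescaled Beta integral, which Euler's identity
  B(x, y) = Gamma(x) Gamma(y) / Gamma(x + y)
turns into the Gamma factors of the bound ([beta_gamma]).

The derivative f''' may be discontinuous, and to recover f'' from it by
integration takes a Lebesgue fundamental theorem of calculus. In its place
stands [holder_increment], a form of Hoelder's inequality for increments.
Pointwise, Young's inequality bounds |V'| by the derivative of an explicit
function, and the mean value theorem compares the increments. Only continuous
functions are recovered from their derivatives by integration
([antiderivative]). *)

(** * Hoelder's inequality for increments *)

(** Both P - V and P + V have a nonnegative derivative, hence increase. *)
Lemma le_derive_dist (R : realType) (a b : R) (V V' P P' : R -> R) : a < b ->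
  {within `[a, b], continuous V} -> {within `[a, b], continuous P} ->
  (forall t, a < t < b -> is_derive t 1 V (V' t)) ->
  (forall t, a < t < b -> is_derive t 1 P (P' t)) ->
  (forall t, a < t < b -> `|V' t| <= P' t) ->
  `|V b - V a| <= P b - P a.
Proof.
move=> ab cV cP dV dP VP.
have mono (W W' : R -> R) : {within `[a, b], continuous W} ->
    (forall t, a < t < b -> is_derive t 1 W (W' t)) ->
    (forall t, a < t < b -> 0 <= W' t) -> W a <= W b.
  move=> cW dW W0; apply: (@ger0_derive1_le_cc _ W a b) => //.
  - by move=> t; rewrite in_itv/= => /dW[].
  - by move=> t; rewrite in_itv/= => tab; have [_ W't] := dW _ tab;
      rewrite derive1E W't; exact: W0.
  - by rewrite in_itv/= lexx ltW.
  - by rewrite in_itv/= lexx ltW.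
  - exact: ltW.
have h1 : (P - V) a <= (P - V) b.
  apply: (mono _ (fun t => P' t - V' t)).
  - by move=> x; apply: cvgB; [exact: cP|exact: cV].
  - by move=> t tab; apply: is_deriveB; [exact: dP|exact: dV].
  - by move=> t /VP; rewrite ler_norml subr_ge0 => /andP[].
have h2 : (P + V) a <= (P + V) b.
  apply: (mono _ (fun t => P' t + V' t)).
  - by move=> x; apply: cvgD; [exact: cP|exact: cV].
  - by move=> t tab; apply: is_deriveD; [exact: dP|exact: dV].
  - by move=> t /VP; rewrite ler_norml => /andP[+ _]; rewrite lerNl -subr_ge0 opprK.
rewrite !fctE/= in h1 h2.
by rewrite ler_norml; apply/andP; split; lra.
Qed.

Lemma le_mul_of_lt (R : realFieldType) (x y D : R) : 0 <= x -> 0 <= y ->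
  (forall X Y, x < X -> y < Y -> D <= X * Y) -> D <= x * y.
Proof.
move=> x0 y0 DXY; apply/ler_addgt0Pr => e e0.
pose d := Num.min 1 (e / (x + y + 1)).
have s0 : 0 < x + y + 1 by rewrite ltr_wpDl// addr_ge0.
have d0 : 0 < d by rewrite lt_min ltr01 divr_gt0.
have d1 : d <= 1 by rewrite ge_min lexx.
have d2 : d * (x + y + 1) <= e by rewrite -ler_pdivlMr// ge_min lexx orbT.
have := DXY (x + d) (y + d); rewrite !ltrDl => /(_ d0 d0) h.
clearbody d; apply: le_trans h _; nra.
Qed.

(** Hoelder's inequality for the integral of k * H, where the three integrals
are replaced by increments of functions with the corresponding derivatives.
For V this needs only a bound on V', and V' may fail to be continuous.
For numbers X and Y larger than the two right-hand norms, Young's inequality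
applied to k / X and H / Y bounds |V'| by the derivative of a combination of
kappa and Q whose increment is at most X * Y. Taking X and Y strictly larger
keeps them positive, also when one of the norms vanishes. *)
Lemma holder_increment (R : realType) (p q a b : R)
    (V V' k H kappa Q Q' : R -> R) :
  a < b -> 0 < p -> 0 < q -> p^-1 + q^-1 = 1 ->
  {within `[a, b], continuous V} -> {within `[a, b], continuous kappa} ->
  {within `[a, b], continuous Q} ->
  (forall t, a < t < b -> is_derive t 1 V (V' t)) ->
  (forall t, a < t < b -> is_derive t 1 kappa (k t `^ p)) ->
  (forall t, a < t < b -> is_derive t 1 Q (Q' t)) ->
  (forall t, a < t < b -> 0 <= k t) -> (forall t, a < t < b -> 0 <= H t) ->
  (forall t, a < t < b -> `|V' t| <= k t * H t) ->
  (forall t, a < t < b -> H t `^ q <= Q' t) ->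
  `|V b - V a| <= (kappa b - kappa a) `^ p^-1 * (Q b - Q a) `^ q^-1.
Proof.
move=> ab p0 q0 pq cV ck cQ dV dk dQ k0 H0 VkH HQ.
have K0 : 0 <= kappa b - kappa a.
  apply: le_trans (normr_ge0 (kappa b - kappa a)) _.
  apply: (le_derive_dist ab ck ck dk dk) => t _.
  by rewrite ger0_norm ?powR_ge0.
have C0 : 0 <= Q b - Q a.
  apply: le_trans (normr_ge0 (Q b - Q a)) _.
  apply: (le_derive_dist ab cQ cQ dQ dQ) => t tab.
  by rewrite ger0_norm// (le_trans (powR_ge0 _ _) (HQ t tab)).
set x := _ `^ p^-1; set y := _ `^ q^-1.
have x0 : 0 <= x by exact: powR_ge0.
have y0 : 0 <= y by exact: powR_ge0.
have xK : x `^ p = kappa b - kappa a.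
  by rewrite -powRrM mulVf ?gt_eqF// powRr1.
have yC : y `^ q = Q b - Q a.
  by rewrite -powRrM mulVf ?gt_eqF// powRr1.
have young X Y : x < X -> y < Y -> `|V b - V a| <= X * Y.
  move=> xX yY.
  have X0 : 0 < X by exact: le_lt_trans xX.
  have Y0 : 0 < Y by exact: le_lt_trans yY.
  have Xp0 : 0 < X `^ p by rewrite powR_gt0.
  have Yq0 : 0 < Y `^ q by rewrite powR_gt0.
  (* P' is X Y ((k / X)^p / p + (Q' / Y^q) / q), the upper bound that Young's
     inequality gives for k H. *)
  pose P t := X * Y * ((p * X `^ p)^-1 * kappa t + (q * Y `^ q)^-1 * Q t).
  have cP : {within `[a, b], continuous P}.
    move=> t; apply: cvgM; first exact: cvg_cst.
    by apply: cvgD; (apply: cvgM; first exact: cvg_cst); [exact: ck|exact: cQ].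
  have dP t : a < t < b -> is_derive t 1 P
      (X * Y * ((p * X `^ p)^-1 * (k t `^ p) + (q * Y `^ q)^-1 * Q' t)).
    move=> tab; have ? := dk t tab; have ? := dQ t tab.
    by apply: is_derive_eq; rewrite /GRing.scale/=; ring.
  have le1 : `|V b - V a| <= P b - P a.
    apply: (le_derive_dist ab cV cP dV dP) => t tab.
    apply: le_trans (VkH t tab) _.
    have -> : k t * H t = X * Y * ((k t / X) * (H t / Y)).
      by field; rewrite !gt_eqF.
    rewrite ler_pM2l ?mulr_gt0//.
    have h := @conjugate_powR R (k t / X) (H t / Y) p q
      (divr_ge0 (k0 t tab) (ltW X0)) (divr_ge0 (H0 t tab) (ltW Y0)) p0 q0 pq.
    apply: le_trans h _.
    rewrite !powRM ?invr_ge0 ?k0 ?H0 ?(ltW X0) ?(ltW Y0)//.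
    have invpow (z w : R) : 0 < z -> z^-1 `^ w = (z `^ w)^-1.
      by move=> z0; rewrite -(powR_inv1 (ltW z0)) powRAC powR_inv1 ?powR_ge0.
    rewrite !invpow//.
    rewrite !invfM. apply: lerD.
      by rewrite mulrC mulrCA mulrC.
    rewrite mulrAC -mulrA mulrC ler_wpM2l ?HQ//.
    by rewrite mulr_ge0// invr_ge0 ltW.
  apply: le_trans le1 _.
  have -> : P b - P a = X * Y * ((p * X `^ p)^-1 * x `^ p + (q * Y `^ q)^-1 * y `^ q).
    by rewrite xK yC /P; ring.
  rewrite ger_pMr ?mulr_gt0// -pq !invfM; apply: lerD.
    rewrite -mulrA ger_pMr ?invr_gt0// mulrC ler_pdivrMr// mul1r.
    by apply: ge0_ler_powR; rewrite ?nnegrE //; exact: ltW.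
  rewrite -mulrA ger_pMr ?invr_gt0// mulrC ler_pdivrMr// mul1r.
  by apply: ge0_ler_powR; rewrite ?nnegrE //; exact: ltW.
exact: le_mul_of_lt.
Qed.

(** * Primitives and the Simpson kernel *)

(** The primitive is based at a point to the left of a, inside the interior of
I, and integrability is taken on an interval that extends beyond b. In this way
F is differentiable on both sides at a and b too, and no one-sided derivative
occurs afterwards. *)
Lemma antiderivative (R : realType) (I : set R) (f : R -> R) (a b : R) :
  is_interval I -> (I°) a -> (I°) b -> a < b ->
  (forall x, (I°) x -> {for x, continuous f}) ->
  exists F : R -> R, (forall x, a <= x <= b -> is_derive x 1 F (f x)) /\
    \int[@lebesgue_measure R]_(x in `[a, b]) f x = F b - F a.
Proof.
move=> itvI Ia Ib ab cf.
have [e /= e0 ae] : exists2 e : R, 0 < e & (I°) (a - e).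
  have /nbhs_ballP[e /= e0 he] : nbhs a (I°) by apply: open_nbhs_nbhs; split => //; exact: open_interior.
  exists (e / 2); first by rewrite divr_gt0.
  apply: he; rewrite /ball/= opprD addrA subrr sub0r opprK ger0_norm; lra.
have [d /= d0 bd] : exists2 d : R, 0 < d & (I°) (b + d).
  have /nbhs_ballP[d /= d0 hd] : nbhs b (I°) by apply: open_nbhs_nbhs; split => //; exact: open_interior.
  exists (d / 2); first by rewrite divr_gt0.
  apply: hd; rewrite /ball/= opprD addrA subrr sub0r normrN ger0_norm; lra.
have Ix x : a - e <= x <= b + d -> (I°) x.
  rewrite !le_eqVlt => /andP[/predU1P[<-//|ax] /predU1P[->//|xb]].
  apply: (filterS (P := `]a - e, b + d[%classic)).
    move=> y /=; rewrite in_itv/= => /andP[ay yb].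
    by apply: (itvI (a - e) (b + d)); rewrite ?ltW//; exact: interior_subset.
  by apply: near_in_itvoo; rewrite in_itv/= ax.
have intf u v : a - e <= u -> v <= b + d ->
    (@lebesgue_measure R).-integrable `[u, v] (EFin \o f).
  move=> au vb; apply: continuous_compact_integrable; first exact: segment_compact.
  apply: continuous_in_subspaceT => x; rewrite inE/= in_itv/= => /andP[ux xv].
  by apply/cf/Ix; rewrite (le_trans au ux) (le_trans xv vb).
pose F x := \int[@lebesgue_measure R]_(t in `[a - e, x]) f t.
exists F; split.
  move=> x /andP[ax xb].
  have [] := @continuous_FTC1_closed R f (a - e) x (b + d).
  - lra.
  - exact: intf.
  - lra.
  - by apply/cf/Ix; apply/andP; split; lra.
  - by move=> dF <-; rewrite derive1E; exact: derivableP.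
rewrite /F Rintegral_itvB; last 3 first.
- by apply: intf; lra.
- by rewrite bnd_simp; lra.
- by rewrite bnd_simp; lra.
apply/esym/Rintegral_itv_obnd_cbnd.
apply: (integrableS _ _ _ (intf a b _ _)) => //; try lra.
by apply: subset_itvr; rewrite bnd_simp.
Qed.

(** Let u = - d (1/2 - t), so that x = m - d (1/2 - t) = m + u. The function is
e(u) - (d t) e'(u) + (d t)^2 / 2 e''(u), where
  e(u) = F(m + u) - u / 3 (f(m + u) + 2 f(m))
is the part of the Simpson error on one side of the midpoint. Since du/dt = d,
differentiation telescopes to d (d t)^2 / 2 e'''(u), and
e'''(u) = - u / 3 f'''(m + u). *)
Lemma half_simpson_is_derive (R : realType) (F f f1 f2 f3 : R -> R) (c d t : R) :
  let x := c + d * t in let m := c + d / 2 in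
  is_derive x 1 F (f x) -> is_derive x 1 f (f1 x) ->
  is_derive x 1 f1 (f2 x) -> is_derive x 1 f2 (f3 x) ->
  is_derive t 1
   (fun t => F (c + d * t)
     + d * (1 / 2 - t) / 3 * (f (c + d * t) + 2 * f m)
     - d * t * (2 / 3 * (f (c + d * t) - f m) + d * (1 / 2 - t) / 3 * f1 (c + d * t))
     + (d * t) ^+ 2 / 2 * (1 / 3 * f1 (c + d * t) + d * (1 / 2 - t) / 3 * f2 (c + d * t)))
   (d ^+ 4 * (t ^+ 2 * (1 / 2 - t) / 6) * f3 x).
Proof.
move=> x m dF df df1 df2.
have dx : is_derive t 1 (fun t => c + d * t) d.
  by apply: is_derive_eq; rewrite /GRing.scale/=; ring.
have comp (g : R -> R) (g' : R) : is_derive x 1 g g' -> is_derive t 1 (fun t => g (c + d * t)) (g' * d).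
  by move=> dg; exact: (is_derive1_comp (f := g)).
have := comp _ _ dF; have := comp _ _ df; have := comp _ _ df1; have := comp _ _ df2.
move=> h2 h1 h0 hF.
apply: is_derive_eq; rewrite /GRing.scale/= -/x.
by field.
Qed.

(** * Truncated powers *)

(** This is the truncated power t_+^x. It extends the integrands of the Gamma and
Beta integrals by zero to continuous functions on the whole line (for x > 0), so
that Tonelli's theorem and affine substitutions apply without domains. The
maximum is necessary because [powR] takes the value 1 at negative bases. *)
Definition truncpow (R : realType) (x t : R) : R := Num.max t 0 `^ x.

Lemma truncpow_pos (R : realType) (x t : R) : 0 < t -> truncpow x t = t `^ x.
Proof. by move=> t0; rewrite /truncpow max_l// ltW. Qed.

Lemma truncpow_nonpos (R : realType) (x t : R) :
  0 < x -> t <= 0 -> truncpow x t = 0.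
Proof. by move=> x0 t0; rewrite /truncpow max_r// powR0// gt_eqF. Qed.

Lemma truncpow_nonneg (R : realType) (x t : R) :
  0 <= t -> truncpow x t = t `^ x.
Proof. by move=> t0; rewrite /truncpow max_l. Qed.

Lemma truncpow_ge0 (R : realType) (x t : R) : 0 <= truncpow x t.
Proof. exact: powR_ge0. Qed.

Lemma truncpowZ (R : realType) (x c t : R) : 0 < c ->
  truncpow x (c * t) = c `^ x * truncpow x t.
Proof.
move=> c0; rewrite /truncpow -powRM; last 2 first.
- exact: ltW.
- by rewrite le_max lexx orbT.
by rewrite maxr_pMr ?ltW// mulr0.
Qed.

Lemma continuous_truncpow (R : realType) (x : R) : 0 < x ->
  continuous (truncpow x).
Proof.
move=> x0 t; have [t0|t0] := ltP 0 t.
  have ct : {for t, continuous (fun u : R => u `^ x)}.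
    apply/differentiable_continuous/derivable1_diffP.
    by have [] := is_derive1_powR x t0.
  rewrite /continuous_at truncpow_pos//; apply: cvg_trans ct.
  apply: near_eq_cvg; near=> u.
  by rewrite truncpow_pos//; near: u; exact: lt_nbhsr.
rewrite /continuous_at truncpow_nonpos//; apply/cvgr0Pnorm_lt => e e0.
have e1 : 0 < e `^ x^-1 by rewrite powR_gt0.
near=> u; rewrite ger0_norm ?truncpow_ge0// /truncpow.
have -> : e = (e `^ x^-1) `^ x by rewrite -powRrM mulVf ?gt_eqF// powRr1// ltW.
apply: gt0_ltr_powR => //; rewrite ?nnegrE ?le_max ?lexx ?orbT ?ltW//.
rewrite gt_max e1 andbT.
by near: u; apply: lt_nbhsl; exact: le_lt_trans e1.
Unshelve. all: by end_near. Qed.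

Lemma continuous_truncpowB (R : realType) (x r : R) : 0 < x ->
  continuous (fun t => truncpow x (r - t)).
Proof.
move=> x0 t.
apply: (continuous_comp (f := fun u => r - u)); last exact: continuous_truncpow.
by apply: cvgB; [exact: cvg_cst|exact: cvg_id].
Qed.

Lemma is_derive_truncpow (R : realType) (x t : R) : 0 < t ->
  is_derive t 1 (truncpow (x + 1)) ((x + 1) * truncpow x t).
Proof.
move=> t0; have := is_derive1_powR (x + 1) t0; rewrite addrK.
rewrite -(truncpow_pos x t0); apply: near_eq_is_derive; near=> u.
by rewrite truncpow_pos//; near: u; exact: lt_nbhsr.
Unshelve. all: by end_near. Qed.

Lemma integral_affine (R : realType) (c d : R) (G : R -> R) : 0 < c ->
  continuous G -> (forall x, 0 <= G x) ->
  (\int[@lebesgue_measure R]_x (G x)%:E =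
   \int[@lebesgue_measure R]_x (c * G (c * x + d))%:E)%E.
Proof.
move=> c0 cG G0; pose F x := c * x + d.
have dF (x : R) : is_derive x 1 F c.
  by rewrite /F; apply: is_derive_eq; rewrite /GRing.scale/=; ring.
have F' : F^`()%classic = cst c.
  by apply/funext => x; rewrite derive1E; have [_] := dF x.
rewrite (@increasing_ge0_integration_by_substitutionT _ F)//; first last.
- apply/cvgryPge => A; near=> x.
  rewrite /F -lerBlDr -ler_pdivrMl//; near: x; exact: nbhs_pinfty_ge.
- apply/cvgrNyPle => A; near=> x.
  rewrite /F -lerBrDr -ler_pdivlMl//; near: x; exact: nbhs_ninfty_le.
- by rewrite F'; exact: is_cvg_cst.
- by rewrite F'; exact: is_cvg_cst.
- by rewrite F'; exact: cst_continuous.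
- by move=> x y xy; rewrite /F ltrD2r ltr_pM2l.
by apply: eq_integral => x _ /=; rewrite F' mulrC.
Unshelve. all: by end_near. Qed.

(** * The Gamma and Beta integrals *)

Lemma measurable_truncpow (R : realType) (x : R) : 0 < x ->
  measurable_fun [set: R] (truncpow x).
Proof. by move=> x0; apply: continuous_measurable_fun; exact: continuous_truncpow. Qed.

Lemma continuous_expRN (R : realType) : continuous (fun t : R => expR (- t)).
Proof.
move=> t; apply: (continuous_comp (f := -%R)); last exact: continuous_expR.
exact: cvgN.
Qed.

Lemma continuous_gamma_integrand (R : realType) (x : R) : 0 < x ->
  continuous (fun t : R => truncpow x t * expR (- t)).
Proof.
move=> x0 t; apply: cvgM; first exact: continuous_truncpow.
exact: continuous_expRN.
Qed.

Lemma measurable_gamma_integrand (R : realType) (x : R) (D : set R) : 0 < x ->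
  measurable_fun D (fun t : R => (truncpow x t * expR (- t))%:E).
Proof.
move=> x0; apply/measurable_EFinP; apply: measurable_funTS.
apply: continuous_measurable_fun.
exact: continuous_gamma_integrand.
Qed.

(** Put v = t / (2 x). From v <= e^v follows v^x <= e^(t / 2), and half of the
exponential decay absorbs this growth. The density of an exponential law serves
as dominating function because its integral is known to be 1. *)
Lemma gamma_integrand_le (R : realType) (x t : R) : 0 < x ->
  truncpow x t * expR (- t) <= 2 * (2 * x) `^ x * exponential_pdf (1 / 2) t.
Proof.
move=> x0; have [t0|t0] := ltP 0 t; last first.
  rewrite truncpow_nonpos// mul0r !mulr_ge0 ?powR_ge0//.
  by apply: exponential_pdf_ge0; lra.
rewrite exponential_pdfE ?(ltW t0)// truncpow_pos//.
have x20 : 0 < 2 * x by rewrite mulr_gt0.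
have u0 : 0 < t / (2 * x) by rewrite divr_gt0.
have le_u : (t / (2 * x)) `^ x <= expR (t / 2).
  have -> : t / 2 = t / (2 * x) * x by field; rewrite gt_eqF.
  rewrite expRM; apply: ge0_ler_powR; rewrite ?nnegrE ?expR_ge0 ?(ltW u0) ?(ltW x0)//.
  by apply: le_trans (expR_ge1Dx _); rewrite lerDr.
(* Only the base of the power is rewritten as 2 x v. *)
have {1}-> : t = 2 * x * (t / (2 * x)) by field; rewrite gt_eqF.
rewrite powRM ?(ltW u0) ?(ltW x20)//.
have -> : 2 * (2 * x) `^ x * (1 / 2 * expR (- (1 / 2) * t)) =
    (2 * x) `^ x * (expR (t / 2) * expR (- t)).
  rewrite -expRD; have -> : t / 2 - t = - (1 / 2) * t by lra.
  by field.
by rewrite -mulrA ler_wpM2l ?powR_ge0// ler_wpM2r ?expR_ge0.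
Qed.

Lemma gamma_integral_lty (R : realType) (x : R) : 0 < x ->
  (\int[@lebesgue_measure R]_t (truncpow x t * expR (- t))%:E < +oo)%E.
Proof.
move=> x0; set c := 2 * (2 * x) `^ x.
have c0 : 0 <= c by rewrite mulr_ge0 ?powR_ge0.
apply: (@le_lt_trans _ _ (\int[@lebesgue_measure R]_t (c%:E * (exponential_pdf (1 / 2) t)%:E))%E).
  apply: ge0_le_integral => //=.
  - by move=> t _; rewrite lee_fin mulr_ge0 ?truncpow_ge0 ?expR_ge0.
  - exact: measurable_gamma_integrand.
  - apply/measurable_EFinP; apply: measurable_funM => //.
    exact: measurable_exponential_pdf.
  - by move=> t _; rewrite lee_fin; exact: gamma_integrand_le.
rewrite ge0_integralZl_EFin//=.
- by rewrite integral_exponential_pdf ?mule1 ?ltry//; lra.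
- by move=> t _; rewrite lee_fin exponential_pdf_ge0//; lra.
- by apply/measurable_EFinP; exact: measurable_exponential_pdf.
Qed.

Lemma gamma_integral (R : realType) (x : R) : 0 < x ->
  (\int[@lebesgue_measure R]_t (truncpow x t * expR (- t))%:E)%E
  = (Gamma (x + 1))%:E.
Proof.
move=> x0.
have eqG : (\int[@lebesgue_measure R]_t (truncpow x t * expR (- t))%:E
  = \int[@lebesgue_measure R]_(t in `]0%R, +oo[) (t `^ (x + 1 - 1) * expR (- t))%:E)%E.
  rewrite [RHS]integral_mkcond; apply: eq_integral => t _.
  rewrite patchE mem_setE in_itv/= andbT; case: ltP => t0.
    by rewrite truncpow_pos// addrK.
  by rewrite truncpow_nonpos// mul0r.
have finG : (\int[@lebesgue_measure R]_t (truncpow x t * expR (- t))%:E)%E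
    \is a fin_num.
  rewrite ge0_fin_numE; first exact: gamma_integral_lty.
  by apply: integral_ge0 => t _; rewrite lee_fin mulr_ge0 ?truncpow_ge0 ?expR_ge0.
by rewrite -(fineK finG) eqG.
Qed.

Lemma Gamma_gt0 (R : realType) (x : R) : 1 < x -> 0 < Gamma x.
Proof.
move=> x1; have x0 : 0 < x - 1 by lra.
rewrite -(subrK 1 x) -lte_fin -gamma_integral//.
apply: (@lt_le_trans _ _ (\int[@lebesgue_measure R]_(t in `[1%R, 2%R]) cst (expR (- 2))%:E t)%E).
  rewrite integral_cst//= lebesgue_measure_itv/= lte_fin ltr1n -EFinD.
  rewrite -EFinM lte_fin mulr_gt0 ?expR_gt0//; lra.
apply: (@le_trans _ _ (\int[@lebesgue_measure R]_(t in `[1%R, 2%R]) (truncpow (x - 1) t * expR (- t))%:E)%E); last first.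
  apply: ge0_subset_integral => //=.
  - exact: measurable_gamma_integrand.
  - by move=> t _; rewrite lee_fin mulr_ge0 ?truncpow_ge0 ?expR_ge0.
apply: ge0_le_integral => //=.
- exact: measurable_gamma_integrand.
- move=> t; rewrite /= in_itv/= => /andP[t1 t2].
  rewrite lee_fin truncpow_pos ?(lt_le_trans _ t1)//.
  rewrite -[leLHS]mul1r ler_pM ?expR_ge0//.
    by rewrite -[leLHS](powRr0 t) ler_powR// ltW.
  by rewrite ler_expR lerN2.
Qed.

(** Homogeneity: the substitution of r u for u extracts the powers of r. For
r <= 0 the two truncated powers have disjoint supports. *)
Lemma truncpow_convolution (R : realType) (x y r : R) : 0 < x -> 0 < y ->
  (\int[@lebesgue_measure R]_u (truncpow x u * truncpow y (r - u))%:E =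
   (truncpow (x + y + 1) r)%:E *
   \int[@lebesgue_measure R]_u (truncpow x u * truncpow y (1 - u))%:E)%E.
Proof.
move=> x0 y0.
have xy0 : 0 < x + y + 1 by lra.
have cG (v : R) : continuous (fun u => truncpow x u * truncpow y (v - u)).
  move=> u; apply: cvgM; first exact: continuous_truncpow.
  exact: continuous_truncpowB.
have G0 (v u : R) : 0 <= truncpow x u * truncpow y (v - u).
  by rewrite mulr_ge0 ?truncpow_ge0.
have [r0|r0] := ltP 0 r; last first.
  rewrite (truncpow_nonpos xy0 r0) mul0e integral0_eq// => u _.
  have [u0|u0] := ltP 0 u; last by rewrite truncpow_nonpos// mul0r.
  by rewrite (truncpow_nonpos y0) ?mulr0//; lra.
rewrite (integral_affine 0 r0 (cG r))//.
have EG0 (u : R) : [set: R] u -> (0 <= (truncpow x u * truncpow y (1 - u))%:E)%E.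
  by rewrite lee_fin.
have mEG : measurable_fun [set: R] (fun u => (truncpow x u * truncpow y (1 - u))%:E).
  apply/measurable_EFinP; apply: measurable_funTS.
  by apply: continuous_measurable_fun; exact: cG.
rewrite -(@ge0_integralZl_EFin _ _ _ (@lebesgue_measure R) _ measurableT _ EG0 mEG _ (truncpow_ge0 _ _)).
apply: eq_integral => u _; rewrite -EFinM; congr EFin.
have -> : r - (r * u + 0) = r * (1 - u) by ring.
rewrite addr0 !truncpowZ// (truncpow_pos _ r0).
have -> : r `^ (x + y + 1) = r `^ x * r `^ y * r.
  by rewrite !powRD ?powRr1 ?(ltW r0) ?(gt_eqF r0) ?implybT.
ring.
Qed.

(** Euler's identity. The convolution of t_+^x e^(-t) and t_+^y e^(-t) is a
multiple of t_+^(x + y + 1) e^(-t), and the factor is the Beta integral by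
[truncpow_convolution]. By Tonelli's theorem the integral of a convolution is
the product of the integrals. The Beta integral is an extended real here; it is
finite because the other factors of the identity are finite and
Gamma (x + y + 2) > 0. *)
Lemma beta_gamma (R : realType) (x y : R) : 0 < x -> 0 < y ->
  (\int[@lebesgue_measure R]_u (truncpow x u * truncpow y (1 - u))%:E)%E =
  (Gamma (x + 1) * Gamma (y + 1) / Gamma (x + y + 2))%:E.
Proof.
move=> x0 y0; set B := (X in X = _).
have B0 : (0 <= B)%E.
  by apply: integral_ge0 => u _; rewrite lee_fin mulr_ge0 ?truncpow_ge0.
have xy0 : 0 < x + y + 1 by lra.
have Gxy : 0 < Gamma (x + y + 2) by apply: Gamma_gt0; lra.
have Gy : (0 < (Gamma (y + 1))%:E)%E by rewrite lte_fin; apply: Gamma_gt0; lra.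
have G0 (z t : R) : 0 <= truncpow z t * expR (- t).
  by rewrite mulr_ge0 ?truncpow_ge0 ?expR_ge0.
have EG0 (z t : R) : [set: R] t -> (0 <= (truncpow z t * expR (- t))%:E)%E.
  by rewrite lee_fin.
have mG (z : R) (z0 : 0 < z) := @measurable_gamma_integrand R z [set: R] z0.
(* h is the integrand of the convolution; r is the convolution variable. *)
pose h (z : R * R) := truncpow x z.1 * truncpow y (z.2 - z.1) * expR (- z.2).
have mh : measurable_fun [set: measurableTypeR R * measurableTypeR R] (EFin \o h).
  apply/measurable_EFinP; apply: measurable_funM; first apply: measurable_funM.
  - exact: (measurableT_comp (measurable_truncpow x0)).
  - apply: (measurableT_comp (measurable_truncpow y0)).
    exact: measurable_funB.
  - apply: (measurableT_comp (continuous_measurable_fun (@continuous_expRN R))).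
    exact: measurable_snd.
have h0 (z : measurableTypeR R * measurableTypeR R) : (0 <= (EFin \o h) z)%E.
  by rewrite lee_fin !mulr_ge0 ?truncpow_ge0 ?expR_ge0.
have swap := @fubini_tonelli _ _ _ _ R (@lebesgue_measure R) (@lebesgue_measure R) _ mh h0.
have key : ((Gamma (x + 1))%:E * (Gamma (y + 1))%:E = (Gamma (x + y + 2))%:E * B)%E.
  transitivity (\int[@lebesgue_measure R]_u \int[@lebesgue_measure R]_r (EFin \o h) (u, r))%E.
    rewrite -(gamma_integral x0).
    rewrite -(@ge0_integralZr _ _ _ (@lebesgue_measure R) _ measurableT _
      (mG x x0) _ (EG0 x) (ltW Gy)).
    apply: eq_integral => u _.
    rewrite -(gamma_integral y0).
    rewrite -(@ge0_integralZl_EFin _ _ _ (@lebesgue_measure R) _ measurableT _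
      (EG0 y) (mG y y0) _ (G0 x u)).
    have cGu : continuous (fun t =>
        truncpow x u * expR (- u) * (truncpow y t * expR (- t))).
      move=> t; apply: cvgM; first exact: cvg_cst.
      exact: continuous_gamma_integrand.
    have Gu0 t : 0 <= truncpow x u * expR (- u) * (truncpow y t * expR (- t)).
      by rewrite mulr_ge0.
    under eq_integral do rewrite -EFinM.
    rewrite (integral_affine (- u) ltr01 cGu Gu0).
    apply: eq_integral => r _; congr EFin; rewrite /h/= !mul1r.
    have -> : expR (- r) = expR (- u) * expR (- (r - u)).
      by rewrite -expRD; congr expR; ring.
    ring.
  rewrite swap.
  transitivity (\int[@lebesgue_measure R]_r ((truncpow (x + y + 1) r * expR (- r))%:E * B))%E; last first.
    rewrite (@ge0_integralZr _ _ _ (@lebesgue_measure R) _ measurableT _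
      (mG _ xy0) _ (EG0 _) B0).
    have <- : x + y + 1 + 1 = x + y + 2 by ring.
    by rewrite (gamma_integral xy0).
  apply: eq_integral => r _.
  have K0 (u : R) : [set: R] u -> (0 <= (truncpow x u * truncpow y (r - u))%:E)%E.
    by rewrite lee_fin mulr_ge0 ?truncpow_ge0.
  have mK : measurable_fun [set: R] (fun u => (truncpow x u * truncpow y (r - u))%:E).
    apply/measurable_EFinP; apply: measurable_funM; first exact: measurable_truncpow.
    by apply: (measurableT_comp (measurable_truncpow y0)); exact: measurable_funB.
  rewrite EFinM muleAC -(truncpow_convolution _ x0 y0) muleC.
  rewrite -(@ge0_integralZl_EFin _ _ _ (@lebesgue_measure R) _ measurableT _
    K0 mK _ (expR_ge0 (- r))).
  by apply: eq_integral => u _; rewrite -EFinM mulrC.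
clearbody B; move: key B0; rewrite -EFinM; clear -Gxy.
case: B => [b||].
- by rewrite -EFinM => -[->] _; congr EFin; field; rewrite gt_eqF.
- by rewrite gt0_muley.
- by [].
Qed.

(** * Simpson's rule on a half interval *)

(** The primitive has a two-sided derivative at 0 and at r because the truncated
integrand is continuous on the whole line. *)
Lemma beta_antiderivative (R : realType) (x y r : R) : 0 < x -> 0 < y -> 0 < r ->
  exists kappa : R -> R,
    (forall t, 0 <= t <= r ->
       is_derive t 1 kappa (t `^ x * (r - t) `^ y)) /\
    kappa r - kappa 0 =
      r `^ (x + y + 1) * (Gamma (x + 1) * Gamma (y + 1) / Gamma (x + y + 2)).
Proof.
move=> x0 y0 r0; pose h t := truncpow x t * truncpow y (r - t).
have ch : continuous h.
  move=> t; apply: cvgM; first exact: continuous_truncpow.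
  exact: continuous_truncpowB.
have IT (t : R) : ([set: R])° t by rewrite interiorT.
have itvT : is_interval [set: R] by [].
have [kappa [dk inck]] := antiderivative itvT (IT 0) (IT r) r0 (fun t _ => ch t).
exists kappa; split.
  move=> t /andP[t0 tr]; have := dk t; rewrite /h !truncpow_nonneg ?subr_ge0//.
  by apply; rewrite t0.
rewrite -inck /Rintegral.
have -> : (\int[@lebesgue_measure R]_(t in `[0%R, r]) (h t)%:E
    = \int[@lebesgue_measure R]_t (truncpow x t * truncpow y (r - t))%:E)%E.
  rewrite integral_mkcond; apply: eq_integral => t _.
  rewrite patchE mem_setE in_itv/=.
  have [t0|t0] := leP 0 t; last by rewrite truncpow_nonpos ?(ltW t0)// mul0r.
  have [//|tr] := leP t r.
  by rewrite (truncpow_nonpos y0) ?mulr0// subr_le0 ltW.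
by rewrite (truncpow_convolution _ x0 y0) (beta_gamma x0 y0) truncpow_pos.
Qed.

(** The p-norm of d^4 t^2 (1/2 - t) / 6 is d^4 / 6 * (1/2)^(3 + 1/p) times the
Beta integral to the power 1/p, and 6 * 2^3 = 48. The term in f1 m is what V keeps at t = 1/2; it depends on d only
through d^2, so it cancels between the two halves of the interval. *)
Lemma half_simpson_le (R : realType) (F f f1 f2 f3 : R -> R) (c d m p q s A B : R) :
  m = c + d / 2 -> 1 < q -> 0 < p -> p^-1 + q^-1 = 1 -> 0 < s ->
  (forall t, 0 <= t <= 1 / 2 -> is_derive (c + d * t) 1 F (f (c + d * t))) ->
  (forall t, 0 <= t <= 1 / 2 -> is_derive (c + d * t) 1 f (f1 (c + d * t))) ->
  (forall t, 0 <= t <= 1 / 2 -> is_derive (c + d * t) 1 f1 (f2 (c + d * t))) ->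
  (forall t, 0 <= t <= 1 / 2 -> is_derive (c + d * t) 1 f2 (f3 (c + d * t))) ->
  (forall t, 0 < t < 1 / 2 ->
    `|f3 (c + d * t)| `^ q <= t `^ s * A + (1 - t) `^ s * B) ->
  `|F m - F c - d / 6 * (f c + 2 * f m) + d ^+ 2 / 24 * f1 m| <=
   d ^+ 4 / 48 * (1 / 2) `^ p^-1
   * (Gamma (2 * p + 1) * Gamma (p + 1) / Gamma (3 * p + 2)) `^ p^-1
   * (1 / (2 `^ (s + 1) * (s + 1)) * A
      + (2 `^ (s + 1) - 1) / (2 `^ (s + 1) * (s + 1)) * B) `^ q^-1.
Proof.
move=> mE q1 p0 pq s0 dF df df1 df2 f3le.
have q0 : 0 < q by exact: lt_trans q1.
have p20 : 0 < 2 * p by rewrite mulr_gt0.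
have s10 : 0 < s + 1 by rewrite addr_gt0.
have h0 : 0 < 1 / 2 :> R by rewrite divr_gt0.
have [kappa [dk inck]] := beta_antiderivative p20 p0 h0.
have dV (t : R) (tI : 0 <= t <= 1 / 2) := half_simpson_is_derive (dF t tI) (df t tI) (df1 t tI) (df2 t tI).
rewrite /= -mE in dV.
set V := (fun t => _) in dV.
pose Q t := (s + 1)^-1 * (A * truncpow (s + 1) t - B * truncpow (s + 1) (1 - t)).
pose C := (d ^+ 4 / 6) `^ p.
have d40 : 0 <= d ^+ 4 / 6 by rewrite mulr_ge0 ?invr_ge0// exprn_even_ge0.
have cV : {within `[0, 1 / 2], continuous V}.
  apply: derivable_within_continuous => t; rewrite in_itv/= => tI.
  by have [] := dV t tI.
have ck : {within `[0, 1 / 2], continuous (fun t => C * kappa t)}.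
  apply: derivable_within_continuous => t; rewrite in_itv/= => tI.
  by have ? := dk t tI; apply: derivableM.
have cQ : {within `[0, 1 / 2], continuous Q}.
  apply: continuous_subspaceT => t; apply: cvgM; first exact: cvg_cst.
  apply: cvgB; apply: cvgM; (try exact: cvg_cst); first exact: continuous_truncpow.
  exact: continuous_truncpowB.
have W (t : R) : 0 < t < 1 / 2 -> 0 <= t <= 1 / 2.
  by move=> /andP[? ?]; rewrite !ltW.
have dk' (t : R) : 0 < t < 1 / 2 -> is_derive t 1 (fun t => C * kappa t)
    ((d ^+ 4 * (t ^+ 2 * (1 / 2 - t) / 6)) `^ p).
  move=> tI; have := dk t (W t tI) => ?; apply: is_derive_eq.
  move: tI => /andP[t0 t1].
  have t10 : 0 <= 1 / 2 - t by rewrite subr_ge0 ltW.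
  have -> : d ^+ 4 * (t ^+ 2 * (1 / 2 - t) / 6) = d ^+ 4 / 6 * (t ^+ 2 * (1 / 2 - t)).
    by field.
  rewrite (powRM _ d40 (mulr_ge0 (sqr_ge0 t) t10)) (powRM _ (sqr_ge0 t) t10).
  by rewrite -(powR_mulrn 2 (ltW t0)) -powRrM.
have dQ (t : R) : 0 < t < 1 / 2 -> is_derive t 1 Q (t `^ s * A + (1 - t) `^ s * B).
  move=> /andP[t0 t1]; have t10 : 0 < 1 - t by lra.
  have dt := is_derive_truncpow s t0.
  have dt1 : is_derive t 1 (fun t => truncpow (s + 1) (1 - t))
      ((s + 1) * truncpow s (1 - t) * -1).
    apply: (is_derive1_comp (f := truncpow (s + 1))).
      exact: is_derive_truncpow.
    by apply: is_derive_eq; rewrite /GRing.scale/=; ring.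
  apply: is_derive_eq.
  rewrite /GRing.scale/= !truncpow_pos//; field.
  by rewrite gt_eqF.
have := holder_increment h0 p0 q0 pq cV ck cQ (fun t tI => dV t (W t tI)) dk' dQ.
move=> /(_ (fun t => `|f3 (c + d * t)|)) hold.
have {hold} : `|V (1 / 2) - V 0| <=
    (C * kappa (1 / 2) - C * kappa 0) `^ p^-1 * (Q (1 / 2) - Q 0) `^ q^-1.
  apply: hold => //.
    move=> t /andP[t0 t1]; rewrite mulr_ge0 ?exprn_even_ge0//.
    by rewrite divr_ge0// mulr_ge0 ?sqr_ge0// subr_ge0 ltW.
  move=> t /andP[t0 t1]; rewrite normrM ger0_norm//.
  rewrite mulr_ge0 ?exprn_even_ge0//.
  by rewrite divr_ge0// mulr_ge0 ?sqr_ge0// subr_ge0 ltW.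
have -> : V (1 / 2) - V 0 = F m - F c - d / 6 * (f c + 2 * f m) + d ^+ 2 / 24 * f1 m.
  have em : c + d * (1 / 2) = m by rewrite mE; field.
  by rewrite /V em mulr0 addr0; field.
have G0 : 0 <= Gamma (2 * p + 1) * Gamma (p + 1) / Gamma (3 * p + 2).
  have ? : 0 < Gamma (2 * p + 1) by apply: Gamma_gt0; lra.
  have ? : 0 < Gamma (p + 1) by apply: Gamma_gt0; lra.
  have ? : 0 < Gamma (3 * p + 2) by apply: Gamma_gt0; lra.
  by apply: divr_ge0; [apply: mulr_ge0|]; exact: ltW.
have -> : Q (1 / 2) - Q 0 = 1 / (2 `^ (s + 1) * (s + 1)) * A
      + (2 `^ (s + 1) - 1) / (2 `^ (s + 1) * (s + 1)) * B.
  rewrite /Q subr0 (truncpow_nonpos s10 (lexx 0)) (truncpow_pos _ ltr01) powR1.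
  have -> : 1 - 1 / 2 = 1 / 2 :> R by field.
  rewrite (truncpow_pos _ h0).
  have -> : (1 / 2) `^ (s + 1) = (2 `^ (s + 1))^-1 :> R.
    by rewrite div1r -powR_inv1// powRAC powR_inv1// powR_ge0.
  field.
  by rewrite !gt_eqF// powR_gt0.
suff -> : (C * kappa (1 / 2) - C * kappa 0) `^ p^-1 = d ^+ 4 / 48 * (1 / 2) `^ p^-1
   * (Gamma (2 * p + 1) * Gamma (p + 1) / Gamma (3 * p + 2)) `^ p^-1 by [].
rewrite -mulrBr inck.
have -> : 2 * p + p + 2 = 3 * p + 2 by ring.
move: G0; set g := _ / Gamma (3 * p + 2) => G0.
rewrite (powRM _ (powR_ge0 _ _) (mulr_ge0 (powR_ge0 _ _) G0)).
rewrite (powRM _ (powR_ge0 _ _) G0).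
rewrite /C -!powRrM mulfV ?gt_eqF// powRr1//.
have -> : (2 * p + p + 1) * p^-1 = 3%:R + p^-1 by field; rewrite gt_eqF.
rewrite powRD; last by apply/implyP => _; rewrite gt_eqF.
rewrite (powR_mulrn 3 (ltW h0)); by field.
Qed.

Theorem theorem3 (R : realType) (I : set R) (f : R -> R) (a b p q s : R)
  (I_itv : is_interval I)
  (I_ge0 : I `<=` [set x | 0 <= x])
  (f_diff3 : forall (k : nat) (x : R), (k < 3)%N -> I° x ->
     derivable (f^`(k)) x 1)
  (Ia : I° a) (Ib : I° b) (ab : a < b)
  (f3_int : (@lebesgue_measure R).-integrable `[a, b] (EFin \o f^`(3)))
  (q1 : 1 < q) (pq : 1 / p + 1 / q = 1)
  (s_gt0 : 0 < s) (s_le1 : s <= 1)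
  (f3_sconvex : s_convex2 s `[a, b] (fun x => `|f^`(3) x| `^ q)) :
  `| \int[@lebesgue_measure R]_(x in `[a, b]) f x
     - (b - a) / 6 * (f a + 4 * f ((a + b) / 2) + f b) |
  <= (b - a) ^+ 4 / 48 * (1 / 2) `^ (1 / p)
     * (Gamma (2 * p + 1) * Gamma (p + 1) / Gamma (3 * p + 2)) `^ (1 / p)
     * ( ( 1 / (2 `^ (s + 1) * (s + 1)) * `|f^`(3) a| `^ q
         + (2 `^ (s + 1) - 1) / (2 `^ (s + 1) * (s + 1)) * `|f^`(3) b| `^ q )
           `^ (1 / q)
       + ( (2 `^ (s + 1) - 1) / (2 `^ (s + 1) * (s + 1)) * `|f^`(3) a| `^ q
         + 1 / (2 `^ (s + 1) * (s + 1)) * `|f^`(3) b| `^ q )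
           `^ (1 / q) ).
Proof.
have q0 : 0 < q by exact: lt_trans q1.
have pq' : p^-1 + q^-1 = 1 by rewrite -pq !div1r.
have p0 : 0 < p.
  by rewrite -invr_gt0 -(addrK q^-1 p^-1) pq' subr_gt0 invf_lt1.
have iI x : a <= x <= b -> (I°) x.
  rewrite !le_eqVlt => /andP[/predU1P[<-//|ax] /predU1P[->//|xb]].
  apply: (filterS (P := `]a, b[%classic)).
    move=> y /=; rewrite in_itv/= => /andP[ay yb].
    by apply: (I_itv a b); rewrite ?ltW//; exact: interior_subset.
  by apply: near_in_itvoo; rewrite in_itv/= ax.
have dfk k x : (k < 3)%N -> (I°) x -> is_derive x 1 (f^`(k)) (f^`(k.+1) x).
  by move=> k3 /(f_diff3 _ _ k3) dk; rewrite derive1nS derive1E; exact: derivableP.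
have cf x : (I°) x -> {for x, continuous f}.
  by move=> /(f_diff3 0%N _ isT) /derivable1_diffP/differentiable_continuous.
have [F [dF incF]] := antiderivative I_itv Ia Ib ab cf.
set l := b - a in f3_sconvex *.
have l0 : 0 < l by rewrite subr_gt0.
have bI t : 0 <= t <= 1 / 2 -> a <= b + - l * t <= b.
  by move=> /andP[t0 t1]; apply/andP; split; rewrite /l; nra.
have aI t : 0 <= t <= 1 / 2 -> a <= a + l * t <= b.
  by move=> /andP[t0 t1]; apply/andP; split; rewrite /l; nra.
have abI : `[a, b]%classic a /\ `[a, b]%classic b.
  by rewrite /= !in_itv/= !lexx ltW.
have convexR t : 0 < t < 1 / 2 -> `|f^`(3) (b + - l * t)| `^ q <=
    t `^ s * `|f^`(3) a| `^ q + (1 - t) `^ s * `|f^`(3) b| `^ q.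
  move=> /andP[t0 t1].
  have -> : b + - l * t = t * a + (1 - t) * b by rewrite /l; ring.
  by apply: f3_sconvex; [exact: abI.1|exact: abI.2| lra | lra | ring].
have convexL t : 0 < t < 1 / 2 -> `|f^`(3) (a + l * t)| `^ q <=
    t `^ s * `|f^`(3) b| `^ q + (1 - t) `^ s * `|f^`(3) a| `^ q.
  move=> /andP[t0 t1].
  have -> : a + l * t = t * b + (1 - t) * a by rewrite /l; ring.
  by apply: f3_sconvex; [exact: abI.2|exact: abI.1| lra | lra | ring].
have mR : (a + b) / 2 = b + - l / 2 by rewrite /l; field.
have mL : (a + b) / 2 = a + l / 2 by rewrite /l; field.
have bR := half_simpson_le mR q1 p0 pq' s_gt0
  (fun t tI => dF _ (bI t tI)) (fun t tI => dfk 0%N _ isT (iI _ (bI t tI)))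
  (fun t tI => dfk 1%N _ isT (iI _ (bI t tI)))
  (fun t tI => dfk 2%N _ isT (iI _ (bI t tI))) convexR.
have bL := half_simpson_le mL q1 p0 pq' s_gt0
  (fun t tI => dF _ (aI t tI)) (fun t tI => dfk 0%N _ isT (iI _ (aI t tI)))
  (fun t tI => dfk 1%N _ isT (iI _ (aI t tI)))
  (fun t tI => dfk 2%N _ isT (iI _ (aI t tI))) convexL.
rewrite (_ : (- l) ^+ 4 = l ^+ 4) in bR; last by ring.
rewrite [X in _ * X `^ q^-1]addrC in bL.
rewrite incF !div1r [leRHS]mulrDr; rewrite !div1r in bR bL.
(* The terms in the derivative at the midpoint cancel. *)
have -> : F b - F a - l / 6 * (f a + 4 * f ((a + b) / 2) + f b) =
  (F ((a + b) / 2) - F a - l / 6 * (f a + 2 * f ((a + b) / 2))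
     + l ^+ 2 / 24 * f^`()%classic ((a + b) / 2)) -
  (F ((a + b) / 2) - F b - - l / 6 * (f b + 2 * f ((a + b) / 2))
     + (- l) ^+ 2 / 24 * f^`()%classic ((a + b) / 2)) by field.
apply: le_trans (ler_normB _ _) _.
by rewrite addrC; exact: lerD.
Qed.
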